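(* The dominance monotone sets of graphs of cardinality $1$ are exactly $\{K_1\}$, $\{2K_1\}$, and $\{K_2\}$.
   Context: All graphs are finite and simple, considered up to isomorphism; $K_n$ is the complete graph on $n$ vertices and $2K_1$ is the graph with two vertices and no edges. For lists $d=(d_1,\dots,d_n)$ and $e=(e_1,\dots,e_p)$ of positive integers in nonincreasing order, $d\succeq e$ if $\sum d_i=\sum e_i$ and $\sum_{i=1}^k e_i\le\sum_{i=1}^k d_i$ for $1\le k\le\min\{p,n\}$. A graph is $\mathcal{F}$-free if no induced subgraph is isomorphic to an element of $\mathcal{F}$; a degree sequence is forcibly $\mathcal{F}$-free if every realization (graph with that degree sequence) is $\mathcal{F}$-free. $\mathcal{F}$ is dominance monotone if whenever $d,e$ are degree sequences with positive terms, $d\succeq e$, and $e$ is forcibly $\mathcal{F}$-free, then $d$ is forcibly $\mathcal{F}$-free. *)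

(* Defs.v *)
From HB Require Import structures.
From mathcomp Require Import all_boot.

Set Implicit Arguments.
Unset Strict Implicit.
Unset Printing Implicit Defensive.

(* As usual, the vertex set is nonempty.  The convention matters: if the null
   graph were allowed, no graph would be {null graph}-free, and so the set
   {null graph} would vacuously be dominance monotone. *)
Record graph := Graph {
  vertex :> finType;
  edge : rel vertex;
  edge_sym : symmetric edge;
  edge_irr : irreflexive edge;
  vertex_gt0 : 0 < #|vertex| }.

Definition iso (G H : graph) : Prop :=
  exists2 f : G -> H,
    bijective f & forall x y : G, edge (f x) (f y) = edge x y.

Definition induced_edge (G : graph) (S : {set G}) : rel {x : G | x \in S} :=
  fun x y => edge (val x) (val y).

Lemma induced_edge_sym (G : graph) (S : {set G}) :
  symmetric (@induced_edge G S).
Proof. by move=> x y; apply: edge_sym. Qed.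

Lemma induced_edge_irr (G : graph) (S : {set G}) :
  irreflexive (@induced_edge G S).
Proof. by move=> x; apply: edge_irr. Qed.

Lemma induced_vertex_gt0 (G : graph) (S : {set G}) :
  0 < #|S| -> 0 < #|{: {x : G | x \in S}}|.
Proof. by rewrite card_sig. Qed.

Definition induced (G : graph) (S : {set G}) (S_gt0 : 0 < #|S|) : graph :=
  Graph (@induced_edge_sym G S) (@induced_edge_irr G S)
        (induced_vertex_gt0 S_gt0).

Lemma ord_gt0 (n : nat) : 0 < n -> 0 < #|'I_n|.
Proof. by rewrite card_ord. Qed.

Definition complete_edge (n : nat) : rel 'I_n := fun i j => i != j.

Lemma complete_edge_sym (n : nat) : symmetric (@complete_edge n).
Proof. by move=> i j; rewrite /complete_edge eq_sym. Qed.

Lemma complete_edge_irr (n : nat) : irreflexive (@complete_edge n).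
Proof. by move=> i; rewrite /complete_edge eqxx. Qed.

Definition complete (n : nat) (n_gt0 : 0 < n) : graph :=
  Graph (@complete_edge_sym n) (@complete_edge_irr n) (ord_gt0 n_gt0).

Definition edgeless_edge (n : nat) : rel 'I_n := fun _ _ => false.

Lemma edgeless_edge_sym (n : nat) : symmetric (@edgeless_edge n).
Proof. by []. Qed.

Lemma edgeless_edge_irr (n : nat) : irreflexive (@edgeless_edge n).
Proof. by []. Qed.

Definition edgeless (n : nat) (n_gt0 : 0 < n) : graph :=
  Graph (@edgeless_edge_sym n) (@edgeless_edge_irr n) (ord_gt0 n_gt0).

Definition K1 : graph := @complete 1 isT.
Definition K2 : graph := @complete 2 isT.
Definition twoK1 : graph := @edgeless 2 isT.

Definition degree (G : graph) (x : G) : nat := #|[set y | edge x y]|.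

Definition degree_sequence (G : graph) : seq nat :=
  sort geq [seq degree x | x <- enum G].

Definition realization (d : seq nat) (G : graph) : Prop :=
  degree_sequence G = d.

Definition is_degree_sequence (d : seq nat) : Prop :=
  exists G : graph, realization d G.

Definition positive (d : seq nat) : bool := all (fun m => 0 < m) d.

Definition dominates (d e : seq nat) : Prop :=
  sumn d = sumn e /\
  forall k : nat, 1 <= k <= minn (size e) (size d) ->
    sumn (take k e) <= sumn (take k d).

Definition graph_set := graph -> Prop.

(* Graphs being considered up to isomorphism, F is the set {H} when it is
   nonempty and all its members are isomorphic to H. *)
Definition is_singleton (F : graph_set) (H : graph) : Prop :=
  (exists G : graph, F G) /\ forall G : graph, F G -> iso G H.

Definition has_cardinality_one (F : graph_set) : Prop :=
  exists H : graph, is_singleton F H.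

Definition free (F : graph_set) (G : graph) : Prop :=
  forall (S : {set G}) (S_gt0 : 0 < #|S|) (H : graph),
    F H -> ~ iso (induced S_gt0) H.

Definition forcibly_free (F : graph_set) (d : seq nat) : Prop :=
  forall G : graph, realization d G -> free F G.

Definition dominance_monotone (F : graph_set) : Prop :=
  forall d e : seq nat,
    is_degree_sequence d -> positive d ->
    is_degree_sequence e -> positive e ->
    dominates d e -> forcibly_free F e -> forcibly_free F d.

(* Main.v *)
(** A graph [H] with at least three vertices is excluded by comparing the degree
    sequence [d] of the join of [H] and a complete graph with a constant
    sequence [e], since a constant sequence is dominated by every sequence of
    the same sum which is not longer.  If [H] has a vertex of degree at least 2,
    then [e = (1,...,1)] is forcibly [H]-free, its only realization being a
    perfect matching.  Otherwise the complement of [H] has a vertex of degree at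
    least 2, and [e = (p-2,...,p-2)] of length [p], realized only by the
    complement of a perfect matching, is forcibly [H]-free; it has the same
    length and sum as [d] when [p] is twice the number of non-edges of [H] and
    the complete graph has [p - #|H|] vertices. *)
Require Import Defs.
From HB Require Import structures.
From mathcomp Require Import all_boot.
From mathcomp Require Import zify.

Set Implicit Arguments.
Unset Strict Implicit.
Unset Printing Implicit Defensive.

(** * Embeddings in place of induced subgraphs *)

Definition embeds (H G : graph) : Prop :=
  exists2 g : H -> G,
    injective g & forall x y : H, edge (g x) (g y) = edge x y.

Lemma iso_sym (G H : graph) : iso G H -> iso H G.
Proof.
case=> f [g fK gK] fE; exists g; first by exists f.
by move=> x y; rewrite -fE !gK.
Qed.

Lemma iso_trans (G H K : graph) : iso G H -> iso H K -> iso G K.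
Proof.
case=> f f_bij fE [g g_bij gE]; exists (g \o f); first exact: bij_comp.
by move=> x y; rewrite /= gE fE.
Qed.

Lemma iso_embeds (G H : graph) : iso G H -> embeds G H.
Proof. by case=> f /bij_inj f_inj fE; exists f. Qed.

Lemma embeds_trans (G H K : graph) : embeds G H -> embeds H K -> embeds G K.
Proof.
case=> f f_inj fE [g g_inj gE]; exists (g \o f); first exact: inj_comp.
by move=> x y; rewrite /= gE fE.
Qed.

Lemma induced_embeds (G : graph) (S : {set G}) (S_gt0 : 0 < #|S|) :
  embeds (induced S_gt0) G.
Proof. by exists val => //; apply: val_inj. Qed.

Lemma embeds_induced (H G : graph) :
  embeds H G -> exists (S : {set G}) (S_gt0 : 0 < #|S|), iso (induced S_gt0) H.
Proof.
case=> g g_inj gE; pose S := [set g x | x in [set: H]].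
have S_gt0 : 0 < #|S| by rewrite card_imset // cardsT vertex_gt0.
have gS x : g x \in S by apply: imset_f; rewrite inE.
exists S, S_gt0; apply: iso_sym.
pose f x : induced S_gt0 := exist _ (g x) (gS x).
exists f; last by move=> x y; apply: gE.
apply: inj_card_bij => [x y /(congr1 val)/g_inj //|].
by rewrite /= card_sig card_imset // cardsT.
Qed.

(** The image of an embedding is an induced copy, and all members of [F] are isomorphic to [H]; from
    here on freeness is handled through embeddings only. *)
Lemma free_singleton (F : graph_set) (H G : graph) :
  is_singleton F H -> free F G <-> ~ embeds H G.
Proof.
case=> [[H0 FH0] FH]; split=> [freeG HG | HG S S_gt0 H1 /FH H1H isoS].
  have [S [S_gt0 isoS]] := embeds_induced (embeds_trans (iso_embeds (FH _ FH0)) HG).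
  exact: freeG FH0 isoS.
apply: HG; apply: embeds_trans (induced_embeds S_gt0).
exact/iso_embeds/iso_sym/(iso_trans isoS).
Qed.

Lemma is_singleton_iso (F : graph_set) (G H : graph) :
  iso G H -> is_singleton F G -> is_singleton F H.
Proof. by move=> GH [F0 FG]; split=> // K /FG /iso_trans; apply. Qed.

(** * Degrees and the handshake lemma *)

Lemma degreeE (G : graph) (x : G) : degree x = \sum_y edge x y.
Proof. by rewrite /degree -sum1_card big_mkcond; apply: eq_bigr => y; rewrite inE; case: edge. Qed.

Lemma degree_lt (G : graph) (x : G) : degree x < #|G|.
Proof.
rewrite /degree -cardsT; apply: proper_card; rewrite properT.
by apply/eqP => /setP/(_ x); rewrite !inE edge_irr.
Qed.

Lemma embeds_degree (H G : graph) (g : H -> G) (x : H) : injective g ->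
  (forall y z, edge (g y) (g z) = edge y z) -> degree x <= degree (g x).
Proof.
move=> g_inj gE; rewrite /degree -(card_imset _ g_inj); apply/subset_leq_card.
by apply/subsetP => _ /imsetP[y + ->]; rewrite !inE gE.
Qed.

(** Both differences count non-neighbours, the vertex itself included, and [g] maps non-neighbours
    injectively to non-neighbours. *)
Lemma embeds_codegree (H G : graph) (g : H -> G) (x : H) : injective g ->
  (forall y z, edge (g y) (g z) = edge y z) ->
  #|H| - degree x <= #|G| - degree (g x).
Proof.
move=> g_inj gE; rewrite /degree.
have cE (K : graph) (y : K) : #|K| - #|[set z | edge y z]| = #|[set z | ~~ edge y z]|.
  rewrite -(cardsC [set z | edge y z]) addKn.
  by apply: eq_card => z; rewrite !inE.
rewrite !cE -(card_imset _ g_inj); apply/subset_leq_card.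
by apply/subsetP => _ /imsetP[y + ->]; rewrite !inE gE.
Qed.

Lemma odd_sum_degree (G : graph) : odd (\sum_(x : G) degree x) = false.
Proof.
under eq_bigr do rewrite degreeE.
(* Ordered pairs are split by the order of their ends; swapping the ends matches the two halves, the
   diagonal contributing nothing. *)
rewrite pair_big /= (bigID (fun p => enum_rank p.1 < enum_rank p.2)) /=.
rewrite [X in _ + X](_ : _ = \sum_(p : G * G | enum_rank p.1 < enum_rank p.2) edge p.1 p.2).
  by rewrite addnn odd_double.
have swapK : involutive (fun p : G * G => (p.2, p.1)) by case.
rewrite [LHS](reindex_inj (inv_inj swapK)) /=.
rewrite big_mkcond [RHS]big_mkcond; apply: eq_bigr => -[x y] _ /=.
rewrite -leqNgt edge_sym leq_eqVlt.
have [/val_inj/enum_rank_inj -> | _] //= := eqVneq (enum_rank x : nat) (enum_rank y).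
by rewrite edge_irr ltnn.
Qed.

(** * Degree sequences and domination of constant sequences *)

Lemma size_degree_sequence (G : graph) : size (degree_sequence G) = #|G|.
Proof. by rewrite size_sort size_map -cardE. Qed.

Lemma sumn_degree_sequence (G : graph) :
  sumn (degree_sequence G) = \sum_(x : G) degree x.
Proof.
by rewrite (perm_sumn (permEl (perm_sort _ _))) sumnE big_map big_enum.
Qed.

Lemma degree_sequence_sorted (G : graph) : sorted geq (degree_sequence G).
Proof. by apply: sort_sorted => m n; apply: leq_total. Qed.

Lemma all_degree_sequence (G : graph) (a : pred nat) :
  reflect (forall x : G, a (degree x)) (all a (degree_sequence G)).
Proof.
rewrite all_sort all_map.
apply: (iffP allP) => [aG x | aG x _]; last exact: aG.
by apply: aG; rewrite mem_enum.
Qed.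

Lemma realization_nseq (G : graph) (p c : nat) :
  realization (nseq p c) G <-> #|G| = p /\ forall x : G, degree x = c.
Proof.
rewrite /realization -size_degree_sequence; split=> [dG | [<- Gc]].
  rewrite dG size_nseq; split=> // x; apply/eqP; move: x.
  by apply/(all_degree_sequence _ (pred1 c)); rewrite dG all_pred1_nseq.
by apply/all_pred1P/all_degree_sequence => x; apply/eqP.
Qed.

Lemma leq_sumn_size (c : nat) (s : seq nat) : all (leq c) s -> size s * c <= sumn s.
Proof. by elim: s => //= x s IHs /andP[cx /IHs]; rewrite mulSn; apply: leq_add. Qed.

Lemma sumn_leq_size (c : nat) (s : seq nat) : all (geq c) s -> sumn s <= size s * c.
Proof. by elim: s => //= x s IHs /andP[xc /IHs]; rewrite mulSn; apply: leq_add. Qed.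

(** If the [k]-th term [m] is at least [c], so are the terms before it. Otherwise every later term
    is at most [c], so the tail has sum at most [(size d - k) * c], which leaves at least [k * c] of
    the total [p * c] to the first [k] terms. *)
Lemma nseq_dominated (d : seq nat) (p c : nat) : sorted geq d ->
  size d <= p -> sumn d = p * c -> dominates d (nseq p c).
Proof.
move=> d_sorted d_le sum_d; split=> [|k]; first by rewrite sum_d sumn_nseq mulnC.
rewrite size_nseq leq_min => /and3P[k_gt0 k_le k_size].
rewrite take_nseq // sumn_nseq mulnC; set m := nth 0 d k.-1.
have d_mono i j : i <= j -> j < size d -> nth 0 d j <= nth 0 d i.
  move=> ij jd; apply: (sorted_leq_nth _ _ 0 d_sorted) => //.
  - by move=> x y z /= yx zx; apply: leq_trans yx.
  - exact: leqnn.
  - by rewrite inE (leq_ltn_trans ij).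
have [c_le | /ltnW m_le] := leqP c m.
  rewrite -[in X in X * _](size_takel k_size); apply: leq_sumn_size.
  apply/(all_nthP 0) => i; rewrite (size_takel k_size) => ik.
  by rewrite nth_take // (leq_trans c_le) // d_mono; lia.
have : sumn (drop k d) <= size (drop k d) * c.
  apply: sumn_leq_size; apply/(all_nthP 0) => i; rewrite size_drop nth_drop => ik /=.
  by apply: leq_trans m_le; apply: d_mono; lia.
by move: sum_d; rewrite -{1}(cat_take_drop k d) sumn_cat size_drop; nia.
Qed.

(** * Join of a graph and a complete graph *)

Section Join.
Variables (H : graph) (r : nat).

Definition join_edge : rel (H + 'I_r) := fun u v =>
  match u, v with
  | inl x, inl y => edge x y
  | inr i, inr j => i != j
  | _, _ => true
  end.

Lemma join_edge_sym : symmetric join_edge.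
Proof. by case=> [x|i] [y|j] //=; [apply: edge_sym | rewrite eq_sym]. Qed.

Lemma join_edge_irr : irreflexive join_edge.
Proof. by case=> [x|i] /=; [apply: edge_irr | rewrite eqxx]. Qed.

Lemma card_join : #|{: H + 'I_r}| = #|H| + r.
Proof. by rewrite card_sum card_ord. Qed.

Lemma join_gt0 : 0 < #|{: H + 'I_r}|.
Proof. by rewrite card_join addn_gt0 vertex_gt0. Qed.

Definition join_complete : graph := Graph join_edge_sym join_edge_irr join_gt0.

Lemma join_complete_embeds : embeds H join_complete.
Proof. by exists inl => // x y []. Qed.

Lemma degree_join_inl (x : H) : @degree join_complete (inl x) = degree x + r.
Proof.
rewrite !degreeE big_sumType /=; congr (_ + _).
by rewrite sum1_card card_ord.
Qed.

Lemma degree_join_inr (i : 'I_r) : @degree join_complete (inr i) = #|H| + r.-1.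
Proof.
rewrite degreeE big_sumType /=; congr (_ + _); first by rewrite sum1_card.
rewrite (bigD1 i) //= eqxx add0n; have := cardC1 i.
rewrite card_ord => <-; rewrite -sum1_card.
by apply: eq_big => // j; rewrite eq_sym => ->.
Qed.

Lemma sum_degree_join : \sum_(u : join_complete) degree u =
  \sum_(x : H) degree x + #|H| * r + r * (#|H| + r.-1).
Proof.
rewrite big_sumType /=; under eq_bigr do rewrite degree_join_inl.
under [X in _ + X]eq_bigr do rewrite degree_join_inr.
by rewrite big_split /= !sum_nat_const card_ord.
Qed.

Lemma join_positive : 0 < r -> positive (degree_sequence join_complete).
Proof.
move=> r_gt0; apply/all_degree_sequence => -[x|i].
  by rewrite degree_join_inl addn_gt0 r_gt0 orbT.
by rewrite degree_join_inr addn_gt0 vertex_gt0.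
Qed.

End Join.

(** * Perfect matchings and their complements *)

Section Matching.
Variables (m : nat) (m_gt0 : 0 < m).

(** The first component names a matching edge, the second one of its two ends. *)
Definition matching_edge : rel ('I_m * bool) :=
  fun u v => (u.1 == v.1) && (u.2 != v.2).
Definition comatching_edge : rel ('I_m * bool) := fun u v => u.1 != v.1.

Lemma matching_edge_sym : symmetric matching_edge.
Proof. by move=> u v; rewrite /matching_edge eq_sym (eq_sym u.2). Qed.

Lemma matching_edge_irr : irreflexive matching_edge.
Proof. by move=> u; rewrite /matching_edge !eqxx. Qed.

Lemma comatching_edge_sym : symmetric comatching_edge.
Proof. by move=> u v; rewrite /comatching_edge eq_sym. Qed.

Lemma comatching_edge_irr : irreflexive comatching_edge.
Proof. by move=> u; rewrite /comatching_edge eqxx. Qed.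

Lemma card_matching : #|{: 'I_m * bool}| = m.*2.
Proof. by rewrite card_prod card_ord card_bool muln2. Qed.

Lemma matching_gt0 : 0 < #|{: 'I_m * bool}|.
Proof. by rewrite card_matching double_gt0. Qed.

Definition matching : graph :=
  Graph matching_edge_sym matching_edge_irr matching_gt0.
Definition comatching : graph :=
  Graph comatching_edge_sym comatching_edge_irr matching_gt0.

Lemma matching_realization : realization (nseq m.*2 1) matching.
Proof.
apply/realization_nseq; split=> [|[i b]]; first exact: card_matching.
rewrite -(cards1 (i, ~~ b)); apply: eq_card => -[j c].
by rewrite !inE /= /matching_edge xpair_eqE /= eq_sym; case: b c => [] [].
Qed.

Lemma comatching_realization : realization (nseq m.*2 (m.*2 - 2)) comatching.
Proof.
apply/realization_nseq; split=> [|[i b]]; first exact: card_matching.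
(* The only non-neighbours of [(i, b)] are the two ends of the pair [i]. *)
rewrite /degree cardsCs card_matching (_ : ~: _ = [set (i, true); (i, false)]).
  by rewrite cards2 xpair_eqE andbF.
apply/setP => -[j c].
rewrite !inE /= /comatching_edge negbK !xpair_eqE /= eq_sym.
by case: c; rewrite ?andbT ?andbF ?orbF.
Qed.

End Matching.

(** * Exclusion of graphs with at least three vertices *)

Lemma regular_not_monotone (F : graph_set) (H R : graph) (r p c : nat) :
  is_singleton F H -> 0 < r -> 0 < c -> #|H| + r <= p ->
  \sum_(u : join_complete H r) degree u = p * c ->
  realization (nseq p c) R ->
  (forall G : graph, realization (nseq p c) G -> ~ embeds H G) ->
  ~ dominance_monotone F.
Proof.
move=> FH r_gt0 c_gt0 p_ge sum_pc realR e_free F_mono.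
set G := join_complete H r.
(* Monotonicity would make this sequence forcibly free, although its realization [G] contains
   [H]. *)
suff d_free : forcibly_free F (degree_sequence G).
  have GF : free F G by apply: d_free.
  by have /(free_singleton _ FH)[] := GF; apply: join_complete_embeds.
apply: (F_mono _ (nseq p c)).
- by exists G.
- exact: join_positive.
- by exists R.
- by rewrite /positive all_nseq c_gt0 orbT.
- apply: nseq_dominated; first exact: degree_sequence_sorted.
    by rewrite size_degree_sequence card_join.
  by rewrite sumn_degree_sequence.
- by move=> K /e_free HK; apply/(free_singleton _ FH).
Qed.

Lemma monotone_small (F : graph_set) (H : graph) :
  is_singleton F H -> dominance_monotone F -> #|H| <= 2.
Proof.
move=> FH F_mono; rewrite leqNgt; apply/negP => H_gt2.
set D := \sum_(x : H) degree x; have D_odd : odd D = false := odd_sum_degree H.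
have [/existsP[x x_gt1] | deg_le1] := boolP [exists x : H, 1 < degree x].
  (* One added vertex already makes all degrees positive; a sequence of ones with the same sum has
     this length. *)
  pose p := \sum_(u : join_complete H 1) degree u.
  have p_even : p./2.*2 = p by rewrite even_halfK // odd_sum_degree.
  have pE : p = D + #|H| * 2 by rewrite /p sum_degree_join; lia.
  have p_gt0 : 0 < p./2 by lia.
  have realM := matching_realization p_gt0; rewrite p_even in realM.
  apply: (regular_not_monotone (r := 1) FH _ _ _ _ realM) F_mono; rewrite ?muln1 //; first by lia.
  move=> G /realization_nseq[_ G1] [g g_inj gE].
  by have := embeds_degree x g_inj gE; rewrite G1 leqNgt x_gt1.
have {}deg_le1 (x : H) : degree x <= 1.
  by rewrite leqNgt; apply: contra deg_le1 => x_gt1; apply/existsP; exists x.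
have D_le : D <= #|H|.
  by rewrite /D -sum1_card; apply: leq_sum => x _.
pose p := #|H| * #|H|.-1 - D; pose r := p - #|H|.
(* Since [D <= #|H|], [p] is at least [#|H| * (#|H| - 2)], enough beyond three vertices. On three
   vertices parity rules out [D = 3], whence [p >= 4]. *)
have p_gt : #|H| < p.
  have [H_gt3 | H_le3] := ltnP 3 #|H|; first by rewrite /p; nia.
  have H3 : #|H| = 3 by lia.
  have D3 : D <> 3 by move=> D3; rewrite D3 in D_odd.
  by move: D_le; rewrite /p H3; lia.
have p_even : p./2.*2 = p.
  rewrite even_halfK // oddB ?D_odd ?addbF; last by nia.
  by rewrite oddM; case: #|H| H_gt2 => //= n _; case: odd.
have p_gt0 : 0 < p./2 by lia.
have realC := comatching_realization p_gt0; rewrite p_even in realC.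
apply: (regular_not_monotone (r := r) FH _ _ _ _ realC) F_mono; try by rewrite /r; lia.
  (* The join has [p] vertices and lacks the same [p] ordered pairs as [H], so its degree sum is
     [p * (p - 1) - p]. *)
  rewrite sum_degree_join -/D.
  have : D + p = #|H| * #|H|.-1 by rewrite /p; nia.
  have : p = #|H| + r by rewrite /r; lia.
  move: p_gt; rewrite /r; clearbody D p; clear; nia.
move=> G /realization_nseq[Gp Gdeg] [g g_inj gE].
(* An embedded [H] would have all degrees at least [#|H| - 2], yet they are at most 1. This forces
   three vertices of degree 1, with an odd degree sum. *)
have codeg (x : H) : #|H| - degree x <= 2.
  by have := embeds_codegree x g_inj gE; rewrite Gp Gdeg; lia.
have D_ge : #|H| <= D.
  by rewrite /D -sum1_card; apply: leq_sum => x _; have := codeg x; lia.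
have [x _] : exists x : H, true by case/card_gt0P: (vertex_gt0 H) => x; exists x.
have H3 : #|H| = 3 by have := codeg x; have := deg_le1 x; lia.
by move: D_odd; rewrite (_ : D = 3) //; lia.
Qed.

(** * Graphs with at most two vertices *)

Lemma embeds_iso (G H : graph) : embeds G H -> #|H| <= #|G| -> iso G H.
Proof. by case=> g g_inj gE HG; exists g => //; apply: inj_card_bij. Qed.

Lemma embeds_K1 (G : graph) : embeds K1 G.
Proof.
have /card_gt0P[x _] := vertex_gt0 G; exists (fun=> x) => [i j _|i j].
  by rewrite !ord1.
by rewrite !ord1 !edge_irr.
Qed.

Lemma embeds_K2 (G : graph) (x y : G) : edge x y -> embeds K2 G.
Proof.
move=> xy; have x_neq_y : x != y by apply: contraTneq xy => ->; rewrite edge_irr.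
exists (fun i : 'I_2 => if i == ord0 then x else y).
  by case=> [[|[]]] // ? [[|[]]] // ? /= /eqP;
    rewrite ?(negPf x_neq_y) 1?eq_sym ?(negPf x_neq_y) // => _; apply: val_inj.
by case=> [[|[]]] // ? [[|[]]] // ? /=; rewrite ?edge_irr // edge_sym.
Qed.

Lemma embeds_twoK1 (G : graph) (x y : G) :
  x != y -> ~~ edge x y -> embeds twoK1 G.
Proof.
move=> x_neq_y /negPf xy; exists (fun i : 'I_2 => if i == ord0 then x else y).
  by case=> [[|[]]] // ? [[|[]]] // ? /= /eqP;
    rewrite ?(negPf x_neq_y) 1?eq_sym ?(negPf x_neq_y) // => _; apply: val_inj.
by case=> [[|[]]] // ? [[|[]]] // ? /=; rewrite ?edge_irr // edge_sym.
Qed.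

(** Both sides say that [G] is complete: a copy of [twoK1] would give a vertex two non-neighbours,
    itself included. *)
Lemma twoK1_free_degree (G : graph) :
  ~ embeds twoK1 G <-> forall x : G, degree x = #|G|.-1.
Proof.
split=> [GF x | G_complete [g g_inj gE]].
  rewrite /degree -(cardsC1 x); apply: eq_card => y; rewrite !inE.
  have [-> | y_neq_x] := eqVneq y x; first by rewrite edge_irr.
  by apply: contra_notT GF; apply: embeds_twoK1; rewrite eq_sym.
have := embeds_codegree (ord0 : twoK1) g_inj gE.
rewrite G_complete card_ord degreeE big1 //.
by have := vertex_gt0 G; lia.
Qed.

Lemma iso_small (G : graph) :
  #|G| <= 2 -> [\/ iso G K1, iso G twoK1 | iso G K2].
Proof.
move=> G_le2; have [/card_gt1P[x [y [_ _ x_neq_y]]] | G_le1] := ltnP 1 #|G|.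
  have [xy | xy] := boolP (edge x y).
    by apply/Or33/iso_sym/embeds_iso; [apply: embeds_K2 xy | rewrite card_ord].
  by apply/Or32/iso_sym/embeds_iso; [apply: embeds_twoK1 xy | rewrite card_ord].
by apply/Or31/iso_sym/embeds_iso; [apply: embeds_K1 | rewrite card_ord].
Qed.

(** Vacuous: every graph contains [K1], so no degree sequence is forcibly free. *)
Lemma K1_monotone (F : graph_set) : is_singleton F K1 -> dominance_monotone F.
Proof.
move=> FK d e _ _ [G Ge] _ _ /(_ G Ge) /(free_singleton _ FK)[].
exact: embeds_K1.
Qed.

(** Vacuous as well: a positive degree yields an edge in any realization of [e]. *)
Lemma K2_monotone (F : graph_set) : is_singleton F K2 -> dominance_monotone F.
Proof.
move=> FK d e _ _ [G Ge] e_gt0 _ /(_ G Ge) /(free_singleton _ FK)[].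
have /card_gt0P[x _] := vertex_gt0 G.
move: e_gt0; rewrite -Ge => /all_degree_sequence/(_ x)/card_gt0P[y].
by rewrite inE; apply: embeds_K2.
Qed.

(** Here [e] belongs to a complete graph, whose degree sum is the largest possible on at most [#|G|]
    vertices. Once [d] is known not to be longer than [e], equality of sums makes all degrees in
    [G'] maximal. *)
Lemma twoK1_monotone (F : graph_set) :
  is_singleton F twoK1 -> dominance_monotone F.
Proof.
move=> FK d e _ d_gt0 [G Ge] _ [sum_de de] /(_ G Ge) /(free_singleton _ FK).
move=> /twoK1_free_degree G_complete G' G'd; apply/(free_singleton _ FK).
apply/twoK1_free_degree; have G_gt0 := vertex_gt0 G.
have eE : e = nseq #|G| #|G|.-1 by rewrite -Ge; apply/realization_nseq.
have sum_e : sumn e = #|G| * #|G|.-1 by rewrite eE sumn_nseq mulnC.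
have d_size : size d = #|G'| by rewrite -G'd size_degree_sequence.
have G'_le : #|G'| <= #|G|.
  (* Were [d] longer, its first [#|G|] terms would already reach the whole sum, leaving nothing for
     the positive terms after them. *)
  rewrite leqNgt; apply/negP => G_lt.
  have := de #|G|; rewrite eE size_nseq d_size leq_min leqnn (ltnW G_lt) G_gt0.
  rewrite -eE take_oversize ?eE ?size_nseq // -eE => /(_ isT).
  rewrite -sum_de -{1}(cat_take_drop #|G| d) sumn_cat.
  have := @leq_sumn_size 1 (drop #|G| d); rewrite size_drop d_size.
  rewrite -{1}(cat_take_drop #|G| d) /positive all_cat in d_gt0.
  by case/andP: d_gt0 => _ -> /(_ isT); lia.
have deg_le (x : G') : degree x <= #|G'|.-1 by have := degree_lt x; lia.
(* A sum of termwise bounds is attained only if every bound is. *)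
have := leqif_sum (fun x (_ : true) => leqif_eq (deg_le x)).
rewrite -sumn_degree_sequence G'd sum_nat_const sum_de sum_e => -[_].
have -> : (#|G| * #|G|.-1 == #|G'| * #|G'|.-1).
  rewrite eqn_leq [X in _ && X]leq_mul ?andbT //; last by lia.
  by rewrite -sum_e -sum_de -G'd sumn_degree_sequence -sum_nat_const leq_sum.
by move=> /esym/forallP G'_complete x; apply/eqP/(implyP (G'_complete x)).
Qed.

Theorem theorem3p5 (F : graph_set) :
  (has_cardinality_one F /\ dominance_monotone F) <->
  (is_singleton F K1 \/ is_singleton F twoK1 \/ is_singleton F K2).
Proof.
split=> [[[H FH] F_mono] | ].
  case: (iso_small (monotone_small FH F_mono)) => /is_singleton_iso/(_ FH) FK.
  - by left.
  - by right; left.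
  - by right; right.
case=> [FK | [FK | FK]]; (split; first by eexists; exact: FK).
- exact: K1_monotone.
- exact: twoK1_monotone.
- exact: K2_monotone.
Qed.
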